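(* Let $k$ be an infinite field, $n\ge1$ an integer, $q=(q_{ij})$ a multiplicatively antisymmetric $n\times n$ matrix over $k^\times$, $R=k_q[[x_1,\ldots,x_n]]$ the $q$-commutative power series ring, $L=k_q[[x_1^{\pm1},\ldots,x_n^{\pm1}]]$ the $q$-commutative Laurent series ring, and let the torus $H=(k^\times)^n$ act on $R$ and $L$ by $h.x^s=h_1^{s_1}\cdots h_n^{s_n}x^s$. (i) Every nonzero $H$-ideal of $R$ is generated by monomials. (ii) $L$ is $H$-simple.
   Context: Multiplicatively antisymmetric means $q_{ii}=1$ and $q_{ij}=q_{ji}^{-1}\in k^\times$ for all $i,j$. The ring $R=k_q[[x_1,\ldots,x_n]]$ is the associative unital $k$-algebra of formal skew power series $\sum_{s\in\mathbb{N}^n} c_s x^s$ ($c_s\in k$, $x^s=x_1^{s_1}\cdots x_n^{s_n}$, $\mathbb{N}$ the non-negative integers), with multiplication determined by $x_ix_j=q_{ij}x_jx_i$. It is a noetherian domain and each $x_i$ is normal. The ring $L$ is the Ore localization of $R$ at the multiplicatively closed set generated by $1,x_1,\ldots,x_n$; its elements are the series $\sum_{s\in\mathbb{Z}^n}c_sx^s$, $c_s\in k$, with $c_s=0$ for $\min\{s_1,\ldots,s_n\}\ll0$. The action of $h=(h_1,\ldots,h_n)\in H$ on monomials extends linearly and continuously (i.e. coefficientwise) to $k$-algebra automorphisms of $R$, and then to the localization $L$. An $H$-ideal is a two-sided ideal stable under the $H$-action; a ring with $H$-action is $H$-simple if its only $H$-ideals are zero and the whole ring. *)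

(* Defs.v *)
From HB Require Import structures.
From mathcomp Require Import all_boot all_order all_algebra all_classical.
From mathcomp Require Import zify ring.
Set Implicit Arguments.
Unset Strict Implicit.
Unset Printing Implicit Defensive.
Import Order.TTheory GRing.Theory Num.Theory.
Local Open Scope classical_set_scope.
Local Open Scope ring_scope.

(* Coefficient of x^u in the product of sum_s f_s x^s and sum_t g_t x^t, when *)
(* x^s x^t = c(s,t) x^(s+t). The \sum_(p \in _) of fsbigop is 0 if infinitely *)
(* many terms are nonzero; qseries_covers and qlaurent_covers show that this  *)
(* never occurs below.                                                        *)
Definition twisted_conv (k : fieldType) (M : nmodType) (c : M -> M -> k)
    (f g : M -> k) (u : M) : k :=
  \sum_(p \in [set p : M * M | p.1 + p.2 = u]) c p.1 p.2 * (f p.1 * g p.2).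

Definition covers (k : fieldType) (M : nmodType) (r : seq M) (u : M)
    (f g : M -> k) :=
  forall s t, s + t = u -> f s != 0 -> g t != 0 -> (s \in r) && (t \in r).

Section Conv.
Variables (k : fieldType) (M : nmodType) (c : M -> M -> k).
Implicit Types (f g h : M -> k) (r : seq M) (u : M).
Local Notation conv := (twisted_conv c).

Lemma twisted_convE r f g u : uniq r -> covers r u f g ->
  conv f g u = \sum_(s <- r) \sum_(t <- r | s + t == u) c s t * (f s * g t).
Proof.
move=> ur cov; rewrite /twisted_conv.
pose r2 := [seq p <- [seq (s, t) | s <- r, t <- r] | p.1 + p.2 == u].
have ur2 : uniq r2 by rewrite filter_uniq// allpairs_uniq// => -[? ?] [? ?].
rewrite (fsbigE r2)//=; first last.
- move=> [s t] /= stu; rewrite mem_filter /= stu eqxx /= => /negP srt.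
  have [->|fs] := eqVneq (f s) 0; first by rewrite mul0r mulr0.
  have [->|gt] := eqVneq (g t) 0; first by rewrite !mulr0.
  case: srt; have /andP[sr tr] := cov _ _ stu fs gt.
  by apply/allpairsP; exists (s, t).
- by move=> [s t] /=; rewrite mem_filter /= => /andP[/eqP].
rewrite big_filter_cond big_mkcond big_allpairs_dep/=; apply: eq_bigr => s _.
rewrite [RHS]big_mkcond/=; apply: eq_bigr => t _.
have [stu|//] := eqVneq (s + t) u.
by rewrite ifT//; apply/mem_set.
Qed.

Lemma twisted_conv_neq0 f g u : conv f g u != 0 ->
  exists s t, [/\ s + t = u, f s != 0 & g t != 0].
Proof.
move=> /(@fsbigN1 _ _ _ unit _ _ (fun _ p => c p.1 p.2 * (f p.1 * g p.2)) tt).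
move=> [[s t] /= stu]; rewrite !mulf_eq0 !negb_or => /and3P[_ fs gt].
by exists s, t.
Qed.

Lemma twisted_convA r f g h u : uniq r ->
  (forall a b v, c a (b + v) * c b v = c (a + b) v * c a b) ->
  (forall a b v, a + b + v = u -> f a != 0 -> g b != 0 -> h v != 0 ->
     [&& a \in r, b \in r, v \in r, a + b \in r & b + v \in r]) ->
  conv f (conv g h) u = conv (conv f g) h u.
Proof.
move=> ur cocycle cov.
rewrite (twisted_convE ur); last first.
  move=> s t stu fs /twisted_conv_neq0[b [v [bvt gb hv]]].
  have := cov s b v; rewrite -addrA bvt => /(_ stu fs gb hv).
  by move=> /and5P[-> _ _ _ ->].
rewrite (twisted_convE ur); last first.
  move=> s v svu /twisted_conv_neq0[a [b [abs fa gb]]] hv.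
  have := cov a b v; rewrite abs => /(_ svu fa gb hv).
  by move=> /and5P[_ _ -> -> _].
transitivity (\sum_(a <- r) \sum_(b <- r) \sum_(v <- r | a + b + v == u)
   c a (b + v) * c b v * (f a * g b * h v)).
  apply: eq_bigr => a _.
  transitivity (\sum_(t <- r | a + t == u)
      \sum_(b <- r) \sum_(v <- r | b + v == t)
      c a (b + v) * c b v * (f a * g b * h v)).
    apply: eq_bigr => t /eqP atu.
    have [fa0|fa] := eqVneq (f a) 0.
      rewrite !(fa0, mul0r, mulr0) big1// => b _; rewrite big1// => v _.
      by rewrite !(mul0r, mulr0).
    rewrite (twisted_convE ur); last first.
      move=> b v bvt gb hv; have := cov a b v; rewrite -addrA bvt.
      by move=> /(_ atu fa gb hv)/and5P[_ -> ->].
    rewrite !mulr_sumr; apply: eq_bigr => b _.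
    rewrite !mulr_sumr; apply: eq_bigr => v /eqP <-.
    by rewrite -!mulrA; congr (_ * _); rewrite mulrCA.
  rewrite exchange_big/=; apply: eq_bigr => b _.
  under eq_bigr do rewrite big_mkcond/=.
  rewrite exchange_big/= [RHS]big_mkcond/=; apply: eq_bigr => v _.
  rewrite big_mkcond/=.
  have [abvu|abvu] := eqVneq (a + b + v) u; last first.
    rewrite big1// => t _; case: eqVneq => // atu; case: eqVneq => // bvt.
    by move: abvu; rewrite -addrA bvt atu eqxx.
  have [e|ne] := eqVneq (c a (b + v) * c b v * (f a * g b * h v)) 0.
    by rewrite e big1// => t _; rewrite !if_same.
  have bvr : b + v \in r.
    move: ne; rewrite !mulf_eq0 !negb_or -!andbA => /and5P[_ _ fa gb hv].
    by have /and5P[] := cov a b v abvu fa gb hv.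
  rewrite (bigD1_seq (b + v))//= addrA abvu !eqxx big1 ?addr0// => t tbv.
  by rewrite (eq_sym (b + v)) (negPf tbv) if_same.
symmetry.
transitivity (\sum_(s <- r) \sum_(v <- r | s + v == u)
    \sum_(a <- r) \sum_(b <- r | a + b == s)
      c a (b + v) * c b v * (f a * g b * h v)).
  apply: eq_bigr => s _; apply: eq_bigr => v /eqP svu.
  have [hv0|hv] := eqVneq (h v) 0.
    rewrite !(hv0, mulr0) big1// => a _; rewrite big1// => b _.
    by rewrite !mulr0.
  rewrite (twisted_convE ur); last first.
    move=> a b abs fa gb; have := cov a b v; rewrite abs.
    by move=> /(_ svu fa gb hv)/and5P[-> ->].
  rewrite mulr_suml mulr_sumr; apply: eq_bigr => a _.
  rewrite mulr_suml mulr_sumr; apply: eq_bigr => b /eqP <-.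
  by rewrite cocycle -!mulrA.
under eq_bigr do rewrite exchange_big/=.
rewrite exchange_big/=; apply: eq_bigr => a _.
under eq_bigr do under eq_bigr do rewrite big_mkcond/=.
under eq_bigr do rewrite exchange_big/=.
rewrite exchange_big/=; apply: eq_bigr => b _.
under eq_bigr do rewrite big_mkcond/=.
rewrite exchange_big/= [RHS]big_mkcond/=; apply: eq_bigr => v _.
have [abvu|abvu] := eqVneq (a + b + v) u; last first.
  rewrite big1// => s _; case: eqVneq => // svu; case: eqVneq => // abs.
  by move: abvu; rewrite abs svu eqxx.
have [e|ne] := eqVneq (c a (b + v) * c b v * (f a * g b * h v)) 0.
  by rewrite e big1// => s _; rewrite !if_same.
have abr : a + b \in r.
  move: ne; rewrite !mulf_eq0 !negb_or -!andbA => /and5P[_ _ fa gb hv].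
  by have /and5P[] := cov a b v abvu fa gb hv.
rewrite (bigD1_seq (a + b))//= abvu !eqxx big1 ?addr0// => s sab.
by rewrite (eq_sym (a + b)) (negPf sab) if_same.
Qed.

Lemma twisted_convDl r f f' g u : uniq r -> covers r u f g -> covers r u f' g ->
  conv (fun s => f s + f' s) g u = conv f g u + conv f' g u.
Proof.
move=> ur cov cov'; rewrite (twisted_convE ur cov) (twisted_convE ur cov').
rewrite (twisted_convE ur).
  rewrite -big_split/=; apply: eq_bigr => s _; rewrite -big_split/=.
  by apply: eq_bigr => t _; rewrite mulrDl mulrDr.
move=> s t stu; have [->|fs _] := eqVneq (f s) 0;
  first by rewrite add0r; exact: cov'.
exact: cov.
Qed.

Lemma twisted_convDr r f g g' u : uniq r -> covers r u f g -> covers r u f g' ->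
  conv f (fun s => g s + g' s) u = conv f g u + conv f g' u.
Proof.
move=> ur cov cov'; rewrite (twisted_convE ur cov) (twisted_convE ur cov').
rewrite (twisted_convE ur).
  rewrite -big_split/=; apply: eq_bigr => s _; rewrite -big_split/=.
  by apply: eq_bigr => t _; rewrite !mulrDr.
move=> s t stu fs; have [->|gt _] := eqVneq (g t) 0;
  first by rewrite add0r; exact: cov'.
exact: cov.
Qed.

Lemma twisted_convZl a f g u : conv (fun s => a * f s) g u = a * conv f g u.
Proof.
rewrite /twisted_conv mulr_fsumr; apply: eq_fsbigr => p _ /=.
by rewrite -mulrA [LHS]mulrCA.
Qed.

Lemma twisted_convZr a f g u : conv f (fun s => a * g s) u = a * conv f g u.
Proof.
rewrite /twisted_conv mulr_fsumr; apply: eq_fsbigr => p _ /=.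
by rewrite mulrA mulrCA -mulrA.
Qed.

Lemma twisted_conv_char (chi : M -> k) f g u :
  (forall s t, chi (s + t) = chi s * chi t) ->
  conv (fun s => chi s * f s) (fun s => chi s * g s) u = chi u * conv f g u.
Proof.
move=> chiD; rewrite /twisted_conv mulr_fsumr; apply: eq_fsbigr => p.
by rewrite inE /= => <-; rewrite chiD; ring.
Qed.

Lemma twisted_conv_single f g s t :
  (forall s' t', s' + t' = s + t -> f s' != 0 -> g t' != 0 ->
     s' = s /\ t' = t) ->
  conv f g (s + t) = c s t * (f s * g t).
Proof.
move=> st1; rewrite /twisted_conv.
transitivity (\sum_(p \in [set (s, t)]) c p.1 p.2 * (f p.1 * g p.2)).
  symmetry; apply: fsbig_widen => [p ->//|[s' t'] /= [e ne]].
  apply/eqP; rewrite !mulf_eq0; case: eqVneq => //= _.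
  case: eqVneq => //= fs; case: eqVneq => //= gt.
  by have [e1 e2] := st1 _ _ e fs gt; rewrite e1 e2 in ne.
by rewrite fsbig_set1.
Qed.

Lemma twisted_conv_monol s f t : injective (+%R s) ->
  conv (fun u => (u == s)%:R) f (s + t) = c s t * f t.
Proof.
move=> sI; rewrite twisted_conv_single ?eqxx ?mul1r// => s' t' e.
by case: (eqVneq s' s) e => [-> /sI->//|_ _]; rewrite eqxx.
Qed.

Lemma twisted_conv_monor s f t : injective (+%R s) ->
  conv f (fun u => (u == s)%:R) (t + s) = c t s * f t.
Proof.
move=> sI; rewrite twisted_conv_single ?eqxx ?mulr1// => t' s' e.
case: (eqVneq s' s) e => [-> |_ _]; last by rewrite eqxx.
by rewrite ![_ + s]addrC => /sI->.
Qed.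

Lemma twisted_conv_eq0 f g u :
  (forall s t, s + t = u -> f s != 0 -> g t != 0 -> False) -> conv f g u = 0.
Proof.
move=> H; apply/eqP; apply: contraT => /twisted_conv_neq0[s [t [? ? ?]]].
by case: (H s t).
Qed.

End Conv.

Definition mult_antisym (k : fieldType) (n : nat) (q : 'M[k]_n) : Prop :=
  [/\ forall i, q i i = 1, forall i j, q i j != 0
    & forall i j, q i j = (q j i)^-1].

(* Moving every x_j of x^t to the left of the x_i of x^s with j < i, by means *)
(* of x_i x_j = q_ij x_j x_i, gives x^s x^t = qcoef q s t x^(s+t); qcoefz is  *)
(* the same scalar for integer exponents. See qseries_varC and qseries_monoE. *)
Definition qcoef (k : fieldType) (n : nat) (q : 'M[k]_n)
    (s t : {ffun 'I_n -> nat}) : k :=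
  \prod_(i < n) \prod_(j < n | (j < i)%N) q i j ^+ (s i * t j).

Definition qcoefz (k : fieldType) (n : nat) (q : 'M[k]_n)
    (s t : {ffun 'I_n -> int}) : k :=
  \prod_(i < n) \prod_(j < n | (j < i)%N) q i j ^ (s i * t j).

Definition bounded_below (k : fieldType) (n : nat)
    (f : {ffun 'I_n -> int} -> k) : Prop :=
  exists m : int, forall s : {ffun 'I_n -> int},
    (exists i, s i < m) -> f s = 0.

Record qseries (k : fieldType) (n : nat) (q : 'M[k]_n) (qP : mult_antisym q) :=
  QSeries { scoef :> {ffun 'I_n -> nat} -> k }.

(* Membership in a subtype is boolean, whence the `[< _ >].                   *)
Record qlaurent (k : fieldType) (n : nat) (q : 'M[k]_n) (qP : mult_antisym q) :=
  QLaurent { lcoef :> {ffun 'I_n -> int} -> k;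
             lcoef_bounded : `[< bounded_below lcoef >] }.

Section Exponents.
Variables (k : fieldType) (n : nat) (q : 'M[k]_n).

Lemma qcoefDl s s' t : qcoef q (s + s') t = qcoef q s t * qcoef q s' t.
Proof.
rewrite /qcoef -big_split; apply: eq_bigr => i _; rewrite -big_split.
by apply: eq_bigr => j _; rewrite ffunE mulnDl exprD.
Qed.

Lemma qcoefDr s t t' : qcoef q s (t + t') = qcoef q s t * qcoef q s t'.
Proof.
rewrite /qcoef -big_split; apply: eq_bigr => i _; rewrite -big_split.
by apply: eq_bigr => j _; rewrite ffunE mulnDr exprD.
Qed.

Lemma qcoef0l t : qcoef q 0 t = 1.
Proof.
by rewrite /qcoef big1// => i _; rewrite big1// => j _; rewrite ffunE.
Qed.

Lemma qcoef0r s : qcoef q s 0 = 1.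
Proof.
by rewrite /qcoef big1// => i _; rewrite big1// => j _; rewrite ffunE muln0.
Qed.

Hypothesis qP : mult_antisym q.

Lemma qcoef_neq0 s t : qcoef q s t != 0.
Proof.
have [_ q0 _] := qP; apply/prodf_neq0 => i _; apply/prodf_neq0 => j _.
exact: expf_neq0.
Qed.

Lemma qcoefzDl s s' t : qcoefz q (s + s') t = qcoefz q s t * qcoefz q s' t.
Proof.
have [_ q0 _] := qP.
rewrite /qcoefz -big_split; apply: eq_bigr => i _; rewrite -big_split.
by apply: eq_bigr => j _; rewrite ffunE mulrDl expfzDr.
Qed.

Lemma qcoefzDr s t t' : qcoefz q s (t + t') = qcoefz q s t * qcoefz q s t'.
Proof.
have [_ q0 _] := qP.
rewrite /qcoefz -big_split; apply: eq_bigr => i _; rewrite -big_split.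
by apply: eq_bigr => j _; rewrite ffunE mulrDr expfzDr.
Qed.

Lemma qcoefz0l t : qcoefz q 0 t = 1.
Proof.
by rewrite /qcoefz big1// => i _; rewrite big1// => j _; rewrite ffunE mul0r.
Qed.

Lemma qcoefz0r s : qcoefz q s 0 = 1.
Proof.
by rewrite /qcoefz big1// => i _; rewrite big1// => j _; rewrite ffunE mulr0.
Qed.

Lemma qcoefz_neq0 s t : qcoefz q s t != 0.
Proof.
have [_ q0 _] := qP; apply/prodf_neq0 => i _; apply/prodf_neq0 => j _.
exact: expfz_neq0.
Qed.

Lemma nat_box (u : {ffun 'I_n -> nat}) :
  exists2 r : seq {ffun 'I_n -> nat}, uniq r &
    forall s : {ffun 'I_n -> nat}, (forall i, (s i <= u i)%N) -> s \in r.
Proof.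
pose N := (\sum_i u i)%N.
pose F (x : {ffun 'I_n -> 'I_N.+1}) := [ffun i => nat_of_ord (x i)].
exists (undup (codom F)); first exact: undup_uniq.
move=> s su; rewrite mem_undup; apply/codomP.
exists [ffun i => inord (s i)]; apply/ffunP => i; rewrite !ffunE inordK// ltnS.
by rewrite (leq_trans (su i))// /N (bigD1 i)//= leq_addr.
Qed.

Lemma int_box (a b : int) :
  exists2 r : seq {ffun 'I_n -> int}, uniq r &
    forall s : {ffun 'I_n -> int}, (forall i, a <= s i <= b) -> s \in r.
Proof.
pose N := `|b - a|%N.
pose F (x : {ffun 'I_n -> 'I_N.+1}) := [ffun i => a + (nat_of_ord (x i))%:Z].
exists (undup (codom F)); first exact: undup_uniq.
move=> s sab; rewrite mem_undup; apply/codomP.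
exists [ffun i => inord `|s i - a|%N]; apply/ffunP => i; rewrite !ffunE.
have /andP[sa sb] := sab i.
rewrite inordK; first by rewrite gez0_abs ?subr_ge0// subrKC.
rewrite ltnS -lez_nat !gez0_abs ?subr_ge0//; first by rewrite lerD2r.
exact: le_trans sb.
Qed.

Lemma ffun_ub (u : {ffun 'I_n -> int}) : exists M : int, forall i, u i <= M.
Proof.
exists (\sum_i `|u i|) => i; rewrite (le_trans (ler_norm _))// (bigD1 i)//=.
by rewrite lerDl sumr_ge0.
Qed.

Lemma bounded_belowP (f : {ffun 'I_n -> int} -> k) :
  bounded_below f <-> exists2 m : int, m <= 0 &
    forall m', m' <= m -> forall s : {ffun 'I_n -> int}, f s != 0 ->
      forall i, m' <= s i.
Proof.
split=> [[m fm]|[m m0 fm]]; last first.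
  exists m => s [i sim]; apply/eqP; apply: contraT => /(fm m (lexx _)) /(_ i).
  by rewrite leNgt sim.
exists (Order.min m 0); first by rewrite ge_min lexx orbT.
move=> m' m'm s fs i; apply: (le_trans m'm); rewrite ge_min leNgt.
apply/orP; left.
by apply: contra fs => sim; apply/eqP/fm; exists i.
Qed.

End Exponents.

Section SeriesRing.
Variables (k : fieldType) (n : nat) (q : 'M[k]_n) (qP : mult_antisym q).
Local Notation R := (qseries qP).
Local Notation E := {ffun 'I_n -> nat}.
Implicit Types (f g h : R) (s t u : E).

HB.instance Definition _ := [isNew for @scoef k n q qP].
HB.instance Definition _ := [Choice of R by <:].

Lemma qseriesP f g : (forall s, f s = g s) <-> f = g.
Proof. by split=> [fg|->//]; apply/val_inj/funext. Qed.

Definition qseries_zero : R := QSeries qP (fun=> 0).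
Definition qseries_opp f : R := QSeries qP (fun s => - f s).
Definition qseries_add f g : R := QSeries qP (fun s => f s + g s).
Definition qseries_mono s : R := QSeries qP (fun t => (t == s)%:R).
Definition qseries_mul f g : R := QSeries qP (twisted_conv (qcoef q) f g).
Definition qseries_scale (a : k) f : R := QSeries qP (fun s => a * f s).

Fact qseries_addA : associative qseries_add.
Proof. by move=> f g h; apply/qseriesP => s /=; rewrite addrA. Qed.
Fact qseries_addC : commutative qseries_add.
Proof. by move=> f g; apply/qseriesP => s /=; rewrite addrC. Qed.
Fact qseries_add0 : left_id qseries_zero qseries_add.
Proof. by move=> f; apply/qseriesP => s /=; rewrite add0r. Qed.
Fact qseries_addN : left_inverse qseries_zero qseries_opp qseries_add.
Proof. by move=> f; apply/qseriesP => s /=; rewrite addNr. Qed.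
HB.instance Definition _ :=
  GRing.isZmodule.Build R qseries_addA qseries_addC qseries_add0 qseries_addN.

Lemma qseries_covers u : exists2 r : seq E, uniq r &
  forall f g : E -> k, covers r u f g.
Proof.
have [r ur rP] := nat_box u; exists r => // f g s t stu _ _.
by rewrite !rP// => i; rewrite -stu ffunE ?leq_addr ?leq_addl.
Qed.

Fact qseries_mulA : associative qseries_mul.
Proof.
move=> f g h; apply/qseriesP => u /=; have [r ur rP] := nat_box u.
apply: (twisted_convA ur) => [a b v|a b v abvu _ _ _].
  by rewrite qcoefDr qcoefDl; ring.
by apply/and5P; split; apply: rP => i; rewrite -abvu !ffunE /=; lia.
Qed.

Lemma natE_addI s : injective (+%R s).
Proof.
move=> t t' /ffunP e; apply/ffunP => i.
by have := e i; rewrite !ffunE => /addnI.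
Qed.

Fact qseries_mul1l : left_id (qseries_mono 0) qseries_mul.
Proof.
move=> f; apply/qseriesP => u /=; rewrite -[u in LHS]add0r.
by rewrite twisted_conv_monol ?qcoef0l ?mul1r//; exact: natE_addI.
Qed.

Fact qseries_mul1r : right_id (qseries_mono 0) qseries_mul.
Proof.
move=> f; apply/qseriesP => u /=; rewrite -[u in LHS]addr0.
by rewrite twisted_conv_monor ?qcoef0r ?mul1r//; exact: natE_addI.
Qed.

Fact qseries_mulDl : left_distributive qseries_mul +%R.
Proof.
move=> f g h; apply/qseriesP => u /=; have [r ur rP] := qseries_covers u.
exact: (twisted_convDl (qcoef q) ur (rP f h) (rP g h)).
Qed.

Fact qseries_mulDr : right_distributive qseries_mul +%R.
Proof.
move=> f g h; apply/qseriesP => u /=; have [r ur rP] := qseries_covers u.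
exact: (twisted_convDr (qcoef q) ur (rP f g) (rP f h)).
Qed.

Fact qseries_1neq0 : qseries_mono 0 != 0.
Proof. by apply/eqP => /qseriesP/(_ 0)/eqP; rewrite /= eqxx oner_eq0. Qed.

HB.instance Definition _ := GRing.Zmodule_isNzRing.Build R
  qseries_mulA qseries_mul1l qseries_mul1r qseries_mulDl qseries_mulDr
  qseries_1neq0.

Fact qseries_scaleA a b f :
  qseries_scale a (qseries_scale b f) = qseries_scale (a * b) f.
Proof. by apply/qseriesP => s /=; rewrite mulrA. Qed.
Fact qseries_scale1 : left_id 1 qseries_scale.
Proof. by move=> f; apply/qseriesP => s /=; rewrite mul1r. Qed.
Fact qseries_scaleDr : right_distributive qseries_scale +%R.
Proof. by move=> a f g; apply/qseriesP => s /=; rewrite mulrDr. Qed.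
Fact qseries_scaleDl f : {morph qseries_scale^~ f : a b / a + b}.
Proof. by move=> a b; apply/qseriesP => s /=; rewrite mulrDl. Qed.
HB.instance Definition _ := GRing.Zmodule_isLmodule.Build k R
  qseries_scaleA qseries_scale1 qseries_scaleDr qseries_scaleDl.

Fact qseries_scaleAl (a : k) f g : a *: (f * g) = (a *: f) * g.
Proof. by apply/qseriesP => u /=; rewrite twisted_convZl. Qed.
HB.instance Definition _ := GRing.Lmodule_isLalgebra.Build k R qseries_scaleAl.
Fact qseries_scaleAr (a : k) f g : a *: (f * g) = f * (a *: g).
Proof. by apply/qseriesP => u /=; rewrite twisted_convZr. Qed.
HB.instance Definition _ := GRing.Lalgebra_isAlgebra.Build k R qseries_scaleAr.

Lemma qseries_monoM s t :
  qseries_mono s * qseries_mono t = qcoef q s t *: qseries_mono (s + t).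
Proof.
apply/qseriesP => u /=; have [->|ust] := eqVneq u (s + t).
  by rewrite twisted_conv_monol ?eqxx//; exact: natE_addI.
rewrite mulr0; apply: twisted_conv_eq0 => s' t'.
case: (eqVneq s' s) => [->|_ _]; last by rewrite eqxx.
case: (eqVneq t' t) => [-> e|_ _ _]; last by rewrite eqxx.
by rewrite e eqxx in ust.
Qed.

End SeriesRing.

Section LaurentRing.
Variables (k : fieldType) (n : nat) (q : 'M[k]_n) (qP : mult_antisym q).
Local Notation L := (qlaurent qP).
Local Notation E := {ffun 'I_n -> int}.
Implicit Types (f g h : L) (s t u : E).

HB.instance Definition _ := [isSub for @lcoef k n q qP].
HB.instance Definition _ := [Choice of L by <:].

Lemma qlaurentP f g : (forall s, f s = g s) <-> f = g.
Proof. by split=> [fg|->//]; apply/val_inj/funext. Qed.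

Lemma lower_bound f : exists2 m : int, m <= 0 &
  forall m', m' <= m -> forall s, f s != 0 -> forall i, m' <= s i.
Proof. exact/bounded_belowP/asboolP/lcoef_bounded. Qed.

Lemma lower_bound2 f g : exists2 m : int, m <= 0 & forall m', m' <= m ->
  (forall s, f s != 0 -> forall i, m' <= s i) /\
  (forall s, g s != 0 -> forall i, m' <= s i).
Proof.
have [m m0 fm] := lower_bound f; have [p p0 gp] := lower_bound g.
exists (Order.min m p); first by rewrite ge_min m0.
by move=> m'; rewrite le_min => /andP[/fm ? /gp].
Qed.

Fact qlaurent_zero_bounded : `[< bounded_below (fun _ : E => 0 : k) >].
Proof. by apply/asboolP; exists 0. Qed.
Fact qlaurent_opp_bounded f : `[< bounded_below (fun s => - f s) >].
Proof.
have [m m0 fm] := lower_bound f; apply/asboolP/bounded_belowP.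
by exists m => // m' m'm s; rewrite oppr_eq0; exact: fm.
Qed.
Fact qlaurent_add_bounded f g : `[< bounded_below (fun s => f s + g s) >].
Proof.
have [m m0 fgm] := lower_bound2 f g; apply/asboolP/bounded_belowP.
exists m => // m' /fgm[fm gm] s fgs i.
have [f0|/fm] := eqVneq (f s) 0; last exact.
by apply: gm; rewrite f0 add0r in fgs.
Qed.
Fact qlaurent_mono_bounded s : `[< bounded_below (fun t => (t == s)%:R : k) >].
Proof.
have [M sM] := ffun_ub (- s); apply/asboolP; exists (- M) => t [i tM].
case: eqVneq => // ts; move: tM; rewrite ts ltNge; case/negP.
by rewrite lerNl; have := sM i; rewrite ffunE.
Qed.
Fact qlaurent_mul_bounded f g :
  `[< bounded_below (twisted_conv (qcoefz q) f g) >].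
Proof.
have [m m0 fgm] := lower_bound2 f g; apply/asboolP/bounded_belowP.
have [fm gm] := fgm m (lexx _).
exists (m + m); first by rewrite -[0]addr0 lerD.
move=> m' m'm u /twisted_conv_neq0[s [t [<- /fm sm /gm tm]]] i.
by rewrite ffunE (le_trans m'm)// lerD.
Qed.
Fact qlaurent_scale_bounded (a : k) f :
  `[< bounded_below (fun s => a * f s) >].
Proof.
have [m m0 fm] := lower_bound f; apply/asboolP/bounded_belowP.
by exists m => // m' m'm s; rewrite mulf_eq0 negb_or => /andP[_]; exact: fm.
Qed.

Definition qlaurent_zero : L := QLaurent qP qlaurent_zero_bounded.
Definition qlaurent_opp f : L := QLaurent qP (qlaurent_opp_bounded f).
Definition qlaurent_add f g : L := QLaurent qP (qlaurent_add_bounded f g).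
Definition qlaurent_mono s : L := QLaurent qP (qlaurent_mono_bounded s).
Definition qlaurent_mul f g : L := QLaurent qP (qlaurent_mul_bounded f g).
Definition qlaurent_scale (a : k) f : L :=
  QLaurent qP (qlaurent_scale_bounded a f).

Fact qlaurent_addA : associative qlaurent_add.
Proof. by move=> f g h; apply/qlaurentP => s /=; rewrite addrA. Qed.
Fact qlaurent_addC : commutative qlaurent_add.
Proof. by move=> f g; apply/qlaurentP => s /=; rewrite addrC. Qed.
Fact qlaurent_add0 : left_id qlaurent_zero qlaurent_add.
Proof. by move=> f; apply/qlaurentP => s /=; rewrite add0r. Qed.
Fact qlaurent_addN : left_inverse qlaurent_zero qlaurent_opp qlaurent_add.
Proof. by move=> f; apply/qlaurentP => s /=; rewrite addNr. Qed.
HB.instance Definition _ := GRing.isZmodule.Build L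
  qlaurent_addA qlaurent_addC qlaurent_add0 qlaurent_addN.

Lemma qlaurent_covers f f' g g' u : exists2 r : seq E, uniq r &
  [/\ covers r u f g, covers r u f' g & covers r u f g'].
Proof.
have [m m0 fm] := lower_bound2 f f'; have [p p0 gp] := lower_bound2 g g'.
have [M uM] := ffun_ub u.
have [mm mp] : Order.min m p <= m /\ Order.min m p <= p.
  by rewrite !ge_min !lexx orbT.
have m'0 : Order.min m p <= 0 by exact: le_trans mm m0.
move: (Order.min m p) mm mp m'0 => {m0 p0} l /fm[{}fm f'm] /gp[{}gp g'p] l0.
have [r ur rP] := int_box n l (M - l).
exists r => //.
have H s t : s + t = u -> (forall i, l <= s i) -> (forall i, l <= t i) ->
    (s \in r) && (t \in r).
  move=> /ffunP stu sl tl; rewrite !rP// => i; have := uM i;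
  rewrite -stu ffunE /=; by have := sl i; have := tl i; lia.
by split=> s t stu fs gt; apply: H; auto.
Qed.

Fact qlaurent_mulA : associative qlaurent_mul.
Proof.
move=> f g h; apply/qlaurentP => u /=.
have [m m0 fm] := lower_bound2 f g; have [p p0 hp] := lower_bound h.
have [M uM] := ffun_ub u.
have [mm mp] : Order.min m p <= m /\ Order.min m p <= p.
  by rewrite !ge_min !lexx orbT.
have m'0 : Order.min m p <= 0 by exact: le_trans mm m0.
move: (Order.min m p) mm mp m'0 => {m0 p0} l /fm[{}fm gm] /hp{}hp l0.
have [r ur rP] := int_box n (l + l) (M - l - l).
apply: (twisted_convA ur) => [a b v|a b v /ffunP abvu fa gb hv].
  by rewrite qcoefzDr// qcoefzDl//; ring.
apply/and5P; split; apply: rP => i; have := uM i; rewrite -abvu !ffunE /=;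
  by have := fm _ fa i; have := gm _ gb i; have := hp _ hv i; lia.
Qed.

Fact qlaurent_mul1l : left_id (qlaurent_mono 0) qlaurent_mul.
Proof.
move=> f; apply/qlaurentP => u /=; rewrite -[u in LHS]add0r.
by rewrite twisted_conv_monol ?qcoefz0l ?mul1r//; exact: addrI.
Qed.

Fact qlaurent_mul1r : right_id (qlaurent_mono 0) qlaurent_mul.
Proof.
move=> f; apply/qlaurentP => u /=; rewrite -[u in LHS]addr0.
by rewrite twisted_conv_monor ?qcoefz0r ?mul1r//; exact: addrI.
Qed.

Fact qlaurent_mulDl : left_distributive qlaurent_mul +%R.
Proof.
move=> f g h; apply/qlaurentP => u /=.
have [r ur [fh gh _]] := qlaurent_covers f g h h u.
exact: (twisted_convDl (qcoefz q) ur fh gh).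
Qed.

Fact qlaurent_mulDr : right_distributive qlaurent_mul +%R.
Proof.
move=> f g h; apply/qlaurentP => u /=.
have [r ur [fg _ fh]] := qlaurent_covers f f g h u.
exact: (twisted_convDr (qcoefz q) ur fg fh).
Qed.

Fact qlaurent_1neq0 : qlaurent_mono 0 != 0.
Proof. by apply/eqP => /qlaurentP/(_ 0)/eqP; rewrite /= eqxx oner_eq0. Qed.

HB.instance Definition _ := GRing.Zmodule_isNzRing.Build L
  qlaurent_mulA qlaurent_mul1l qlaurent_mul1r qlaurent_mulDl qlaurent_mulDr
  qlaurent_1neq0.

Fact qlaurent_scaleA a b f :
  qlaurent_scale a (qlaurent_scale b f) = qlaurent_scale (a * b) f.
Proof. by apply/qlaurentP => s /=; rewrite mulrA. Qed.
Fact qlaurent_scale1 : left_id 1 qlaurent_scale.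
Proof. by move=> f; apply/qlaurentP => s /=; rewrite mul1r. Qed.
Fact qlaurent_scaleDr : right_distributive qlaurent_scale +%R.
Proof. by move=> a f g; apply/qlaurentP => s /=; rewrite mulrDr. Qed.
Fact qlaurent_scaleDl f : {morph qlaurent_scale^~ f : a b / a + b}.
Proof. by move=> a b; apply/qlaurentP => s /=; rewrite mulrDl. Qed.
HB.instance Definition _ := GRing.Zmodule_isLmodule.Build k L
  qlaurent_scaleA qlaurent_scale1 qlaurent_scaleDr qlaurent_scaleDl.

Fact qlaurent_scaleAl (a : k) f g : a *: (f * g) = (a *: f) * g.
Proof. by apply/qlaurentP => u /=; rewrite twisted_convZl. Qed.
HB.instance Definition _ := GRing.Lmodule_isLalgebra.Build k L qlaurent_scaleAl.
Fact qlaurent_scaleAr (a : k) f g : a *: (f * g) = f * (a *: g).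
Proof. by apply/qlaurentP => u /=; rewrite twisted_convZr. Qed.
HB.instance Definition _ := GRing.Lalgebra_isAlgebra.Build k L qlaurent_scaleAr.

Lemma qlaurent_monoM s t :
  qlaurent_mono s * qlaurent_mono t = qcoefz q s t *: qlaurent_mono (s + t).
Proof.
apply/qlaurentP => u /=; have [->|ust] := eqVneq u (s + t).
  by rewrite twisted_conv_monol ?eqxx//; exact: addrI.
rewrite mulr0; apply: twisted_conv_eq0 => s' t'.
case: (eqVneq s' s) => [->|_ _]; last by rewrite eqxx.
case: (eqVneq t' t) => [-> e|_ _ _]; last by rewrite eqxx.
by rewrite e eqxx in ust.
Qed.

End LaurentRing.

Section Generators.
Variables (k : fieldType) (n : nat) (q : 'M[k]_n) (qP : mult_antisym q).
Local Notation E := {ffun 'I_n -> nat}.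

Definition qseries_var (i : 'I_n) : qseries qP :=
  qseries_mono qP [ffun j => (j == i : nat)].

Lemma qcoef_single (i : 'I_n) (a : nat) (t : E) :
  qcoef q [ffun j => (a * (j == i))%N] t =
  \prod_(j < n | (j < i)%N) q i j ^+ (a * t j).
Proof.
rewrite /qcoef (bigD1 i)//= [X in _ * X]big1 ?mulr1 => [|l li].
  by apply: eq_bigr => j _; rewrite ffunE eqxx muln1.
by rewrite big1// => j _; rewrite ffunE (negPf li) muln0.
Qed.

Lemma qcoef_var (i j : 'I_n) :
  qcoef q [ffun l => (l == i : nat)] [ffun l => (l == j : nat)] =
  if (j < i)%N then q i j else 1.
Proof.
have -> : [ffun l => (l == i : nat)] = [ffun l => (1 * (l == i))%N].
  by apply/ffunP => l; rewrite !ffunE mul1n.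
rewrite qcoef_single; case: ifPn => ji.
  rewrite (bigD1 j)//= ffunE eqxx expr1 big1 ?mulr1// => l /andP[_ lj].
  by rewrite ffunE (negPf lj).
rewrite big1// => l li; rewrite ffunE; case: eqVneq li => // ->.
by rewrite (negPf ji).
Qed.

Lemma qseries_varC (i j : 'I_n) :
  qseries_var i * qseries_var j = q i j *: (qseries_var j * qseries_var i).
Proof.
have [q1 q0 qV] := qP.
rewrite /qseries_var !qseries_monoM !qcoef_var scalerA [in RHS]addrC.
congr (_ *: _).
case: ltngtP => [ji|ij|/val_inj ->]; first by rewrite mulr1.
  by rewrite (qV i j) mulVf.
by rewrite q1 mulr1.
Qed.

Lemma qseries_varX (i : 'I_n) (a : nat) :
  qseries_var i ^+ a = qseries_mono qP [ffun j => (a * (j == i))%N].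
Proof.
elim: a => [|a IH].
  by rewrite expr0; congr qseries_mono; apply/ffunP => j; rewrite !ffunE.
rewrite exprSr IH qseries_monoM qcoef_single big1 ?scale1r => [|j ji].
  by congr qseries_mono; apply/ffunP => j; rewrite !ffunE mulSn addnC.
by rewrite ffunE; case: eqVneq ji => [->|_ _]; rewrite ?ltnn// muln0.
Qed.

Lemma qseries_monoE (s : E) :
  qseries_mono qP s = \prod_(i < n) qseries_var i ^+ s i.
Proof.
have [r er] : exists r, r = index_enum 'I_n by exists (index_enum 'I_n).
have rs : pairwise (fun i j : 'I_n => (i < j)%N) r.
  rewrite er /index_enum -enumT -(pairwise_map val ltn) val_enum_ord.
  by rewrite -sorted_pairwise ?iota_ltn_sorted//; exact: ltn_trans.
have -> : s = \sum_(i <- r) [ffun j => (s i * (j == i))%N].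
  apply/ffunP => j; rewrite er sum_ffunE (bigD1 j)//= ffunE eqxx muln1.
  by rewrite big1 ?addr0// => i ij; rewrite ffunE eq_sym (negPf ij) muln0.
rewrite -er.
suff H : \prod_(i <- r) qseries_var i ^+ s i =
    qseries_mono qP (\sum_(i <- r) [ffun j => (s i * (j == i))%N]).
  rewrite -H; apply: eq_big_seq => i _; congr (_ ^+ _).
  rewrite er sum_ffunE (bigD1 i)//= ffunE eqxx muln1.
  by rewrite big1 ?addr0// => j ji; rewrite ffunE eq_sym (negPf ji) muln0.
elim: r rs {er} => [|i r IH]; first by rewrite !big_nil.
rewrite pairwise_cons => /andP[/allP ir /IH{}IH].
rewrite !big_cons IH qseries_varX qseries_monoM qcoef_single big1 ?scale1r//.
move=> j ji; rewrite sum_ffunE big_seq big1 ?muln0// => l lr.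
rewrite ffunE; case: eqVneq => [jl|]; last by rewrite muln0.
by have := ir _ lr; rewrite -jl ltnNge ltnW.
Qed.

End Generators.

Section Embedding.
Variables (k : fieldType) (n : nat) (q : 'M[k]_n) (qP : mult_antisym q).
Local Notation N := {ffun 'I_n -> nat}.
Local Notation Z := {ffun 'I_n -> int}.

Definition expz (s : N) : Z := [ffun i => (s i)%:Z].
Definition absz_exp (s : Z) : N := [ffun i => `|s i|%N].

Lemma expzK : cancel expz absz_exp.
Proof. by move=> s; apply/ffunP => i; rewrite !ffunE. Qed.

Lemma absz_expK (s : Z) : (forall i, 0 <= s i) -> expz (absz_exp s) = s.
Proof. by move=> s0; apply/ffunP => i; rewrite !ffunE gez0_abs. Qed.

Lemma expzD s t : expz (s + t) = expz s + expz t.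
Proof. by apply/ffunP => i; rewrite !ffunE. Qed.

Lemma expz_ge0 s i : 0 <= expz s i.
Proof. by rewrite ffunE. Qed.

Lemma qcoefz_expz s t : qcoefz q (expz s) (expz t) = qcoef q s t.
Proof.
apply: eq_bigr => i _; apply: eq_bigr => j _.
by rewrite !ffunE -PoszM -exprnP.
Qed.

Definition embed_coef (f : qseries qP) (s : Z) : k :=
  if [forall i, 0 <= s i] then f (absz_exp s) else 0.

Fact embed_bounded (f : qseries qP) : `[< bounded_below (embed_coef f) >].
Proof.
apply/asboolP; exists 0 => s [i si]; rewrite /embed_coef ifF//.
by apply/forallP => /(_ i); rewrite leNgt si.
Qed.

Definition qlaurent_of_series (f : qseries qP) : qlaurent qP :=
  QLaurent qP (embed_bounded f).

Lemma embed_expz f s : qlaurent_of_series f (expz s) = f s.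
Proof.
by rewrite /= /embed_coef expzK ifT//; apply/forallP => i; exact: expz_ge0.
Qed.

Lemma embed_neq0 f s : qlaurent_of_series f s != 0 -> exists s', s = expz s'.
Proof.
rewrite /= /embed_coef; case: ifPn => [/forallP s0 _|]; last by rewrite eqxx.
by exists (absz_exp s); rewrite absz_expK.
Qed.

Lemma embed_outside f s :
  (forall s', s <> expz s') -> qlaurent_of_series f s = 0.
Proof.
by move=> H; apply/eqP; apply: contraT => /embed_neq0[s' e]; case: (H s').
Qed.

Lemma embedP (f : qseries qP) (g : qlaurent qP) :
  (forall s, g (expz s) = f s) ->
  (forall s, (forall s', s <> expz s') -> g s = 0) ->
  g = qlaurent_of_series f.
Proof.
move=> gf g0; apply/qlaurentP => s.
have [[s' ->]|/forallNP ns] := pselect (exists s', s = expz s').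
  by rewrite embed_expz gf.
by rewrite embed_outside ?g0.
Qed.

Fact embed_is_zmod_morphism : zmod_morphism qlaurent_of_series.
Proof.
move=> f g; apply/esym/embedP => [s|s ns] /=.
  by rewrite -[embed_coef f _]/(qlaurent_of_series f _)
             -[embed_coef g _]/(qlaurent_of_series g _) !embed_expz.
by rewrite -[embed_coef f _]/(qlaurent_of_series f _)
           -[embed_coef g _]/(qlaurent_of_series g _) !embed_outside ?subr0.
Qed.

Lemma embed_mono s : qlaurent_of_series (qseries_mono qP s) =
  qlaurent_mono qP (expz s).
Proof.
apply/esym/embedP => [t|t nt] /=; first by rewrite (can_eq expzK).
by case: eqVneq => // /nt.
Qed.

Lemma expz0 : expz 0 = 0.
Proof. by apply/ffunP => i; rewrite !ffunE. Qed.

Fact embed_is_monoid_morphism : monoid_morphism qlaurent_of_series.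
Proof.
split; first by rewrite -[1]/(qseries_mono qP 0) embed_mono expz0.
move=> f g; apply/esym/embedP => [u|u nu]; last first.
  apply: twisted_conv_eq0 => s t stu /embed_neq0[s' es] /embed_neq0[t' et].
  by apply: (nu (s' + t')); rewrite -stu es et expzD.
rewrite /= /twisted_conv.
pose F (p : Z * Z) := qcoefz q p.1 p.2 *
  (qlaurent_of_series f p.1 * qlaurent_of_series g p.2).
pose e (p : N * N) := (expz p.1, expz p.2).
rewrite -[LHS]/(\sum_(p \in [set p : Z * Z | p.1 + p.2 = expz u]) F p).
rewrite -(fsbig_widen (e @` [set p | p.1 + p.2 = u])).
- rewrite fsbig_image; last first.
    by move=> [a b] [c d] _ _ [/(can_inj expzK)-> /(can_inj expzK)->].
  by apply: eq_fsbigr => -[a b] _; rewrite /F /e /= qcoefz_expz -!embed_expz.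
- by move=> _ [[a b] /= <- <-] /=; rewrite expzD.
move=> [s t] /= [stu nst]; apply/eqP; rewrite /F /= mulf_eq0 mulf_eq0.
apply/or3P; apply: contrapT => nz; apply: nst.
have [s' es] : exists s', s = expz s'.
  by apply: (@embed_neq0 f); apply/negP => ?; apply: nz; exact: Or32.
have [t' et] : exists t', t = expz t'.
  by apply: (@embed_neq0 g); apply/negP => ?; apply: nz; exact: Or33.
exists (s', t'); last by rewrite /e es et.
by apply: (can_inj expzK); rewrite /= expzD -es -et.
Qed.

HB.instance Definition _ := GRing.isZmodMorphism.Build
  (qseries qP) (qlaurent qP) qlaurent_of_series embed_is_zmod_morphism.
HB.instance Definition _ := GRing.isMonoidMorphism.Build
  (qseries qP) (qlaurent qP) qlaurent_of_series embed_is_monoid_morphism.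

Lemma embed_inj : injective qlaurent_of_series.
Proof.
by move=> f g e; apply/qseriesP => s; rewrite -!embed_expz e.
Qed.

(* The next two lemmas, with the injective morphism above, exhibit L as the   *)
(* localization of R at the monomials.                                        *)
Lemma qlaurent_mono_unit (s : Z) : exists y : qlaurent qP,
  y * qlaurent_mono qP s = 1 /\ qlaurent_mono qP s * y = 1.
Proof.
have c0 a b : qcoefz q a b != 0 := qcoefz_neq0 qP a b.
exists ((qcoefz q s (- s))^-1 *: qlaurent_mono qP (- s)).
have e : qcoefz q s (- s) = qcoefz q (- s) s.
  have := qcoefzDl qP s (- s) s; rewrite subrr qcoefz0l => e1.
  have := qcoefzDr qP s s (- s); rewrite subrr qcoefz0r => e2.
  have := c0 s s => ss; apply: (mulfI ss).
  by rewrite -e2 -e1.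
split; rewrite -?scalerAl -?scalerAr qlaurent_monoM scalerA.
  by rewrite e mulVf// scale1r addNr.
by rewrite mulVf// scale1r subrr.
Qed.

Lemma qlaurent_fraction (f : qlaurent qP) : exists (s : N) (g : qseries qP),
  qlaurent_of_series (qseries_mono qP s) * f = qlaurent_of_series g.
Proof.
have [m m0 fm] := lower_bound f; pose s : N := [ffun=> `|m|%N].
exists s, (QSeries qP (fun t => (qlaurent_mono qP (expz s) * f) (expz t))).
rewrite embed_mono; apply: embedP => // t nt.
apply: twisted_conv_eq0 => a b /ffunP abt /=.
case: (eqVneq a) abt => [-> abt _ fb|_ _]; last by rewrite eqxx.
apply: (nt (absz_exp t)); rewrite absz_expK// => i; rewrite -abt /s !ffunE.
by rewrite lez0_abs// addrC subr_ge0; exact: (fm m (lexx _) _ fb).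
Qed.

End Embedding.

Section TorusAction.
Variables (k : fieldType) (n : nat) (q : 'M[k]_n) (qP : mult_antisym q).
Implicit Type h : {ffun 'I_n -> k}.

Definition torus : set {ffun 'I_n -> k} := [set h | forall i, h i != 0].

Definition qseries_act h (f : qseries qP) : qseries qP :=
  QSeries qP (fun s => (\prod_(i < n) h i ^+ s i) * f s).

Fact qlaurent_act_bounded h (f : qlaurent qP) :
  `[< bounded_below (fun s : {ffun 'I_n -> int} =>
        (\prod_(i < n) h i ^ s i) * f s) >].
Proof.
have /asboolP[m fm] := lcoef_bounded f.
by apply/asboolP; exists m => s /fm ->; rewrite mulr0.
Qed.

Definition qlaurent_act h (f : qlaurent qP) : qlaurent qP :=
  QLaurent qP (qlaurent_act_bounded h f).

Lemma qseries_act_linear h : linear (qseries_act h).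
Proof.
by move=> a f g; apply/qseriesP => s /=; rewrite mulrDr mulrCA.
Qed.

Lemma qseries_act_monoid_morphism h : monoid_morphism (qseries_act h).
Proof.
split=> [|f g]; apply/qseriesP => s /=.
  case: eqVneq => [->|]; last by rewrite mulr0.
  by rewrite big1 ?mulr1// => i _; rewrite ffunE.
rewrite (twisted_conv_char (qcoef q)
  (chi := fun s : {ffun 'I_n -> nat} => \prod_(i < n) h i ^+ s i))//.
by move=> s1 s2; rewrite -big_split; apply: eq_bigr => i _; rewrite ffunE exprD.
Qed.

Lemma qseries_act_mono h s :
  qseries_act h (qseries_mono qP s) =
  (\prod_(i < n) h i ^+ s i) *: qseries_mono qP s.
Proof.
by apply/qseriesP => t /=; case: (eqVneq t s) => [->//|_]; rewrite !mulr0.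
Qed.

Lemma qlaurent_act_mono h s :
  qlaurent_act h (qlaurent_mono qP s) =
  (\prod_(i < n) h i ^ s i) *: qlaurent_mono qP s.
Proof.
by apply/qlaurentP => t /=; case: (eqVneq t s) => [->//|_]; rewrite !mulr0.
Qed.

Lemma qlaurent_act_linear h : linear (qlaurent_act h).
Proof.
by move=> a f g; apply/qlaurentP => s /=; rewrite mulrDr mulrCA.
Qed.

Lemma qlaurent_act_monoid_morphism h :
  torus h -> monoid_morphism (qlaurent_act h).
Proof.
move=> h0; split=> [|f g]; apply/qlaurentP => s /=.
  case: eqVneq => [->|]; last by rewrite mulr0.
  by rewrite big1 ?mulr1// => i _; rewrite ffunE.
rewrite (twisted_conv_char (qcoefz q)
  (chi := fun s : {ffun 'I_n -> int} => \prod_(i < n) h i ^ s i))//.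
move=> s1 s2; rewrite -big_split; apply: eq_bigr => i _.
by rewrite ffunE expfzDr.
Qed.

Lemma qlaurent_act_embed h (f : qseries qP) :
  qlaurent_act h (qlaurent_of_series f) = qlaurent_of_series (qseries_act h f).
Proof.
apply: embedP => [s|s ns] /=.
  rewrite -[embed_coef f _]/(qlaurent_of_series f _) embed_expz; congr (_ * _).
  by apply: eq_bigr => i _; rewrite ffunE.
by rewrite -[embed_coef f _]/(qlaurent_of_series f _) embed_outside ?mulr0.
Qed.

End TorusAction.

Definition two_sided_ideal (A : nzRingType) (I : set A) : Prop :=
  [/\ I 0, forall x y, I x -> I y -> I (x - y),
      forall a x, I x -> I (a * x) & forall a x, I x -> I (x * a)].

Definition ideal_gen (A : nzRingType) (X : set A) : set A :=
  smallest (@two_sided_ideal A) X.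

Lemma ideal_gen_ideal (A : nzRingType) (X : set A) :
  two_sided_ideal (ideal_gen X).
Proof.
split=> [I [[]]//|x y Ix Iy I II|a x Ix I II|a x Ix I II];
  have [[? IB IM MI] _] := II.
- by apply: IB; [exact: Ix|exact: Iy].
- by apply: IM; exact: Ix.
- by apply: MI; exact: Ix.
Qed.

Definition H_ideal (T : Type) (H : set T) (A : nzRingType) (act : T -> A -> A)
    (I : set A) : Prop :=
  two_sided_ideal I /\ forall h x, H h -> I x -> I (act h x).

Definition H_simple (T : Type) (H : set T) (A : nzRingType)
    (act : T -> A -> A) : Prop :=
  forall I : set A, H_ideal H act I -> I = [set 0] \/ I = [set: A].

(* Main.v *)
Require Import Defs.
From mathcomp Require Import all_boot all_order all_algebra all_classical.
From mathcomp Require Import finmap zify.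
Set Implicit Arguments.
Unset Strict Implicit.
Unset Printing Implicit Defensive.
Import Order.TTheory GRing.Theory Num.Theory.
Local Open Scope classical_set_scope.
Local Open Scope ring_scope.

(* Let f lie in an H-ideal I of R. By Dickson's lemma the support of f has a  *)
(* finite subset r such that every element of the support dominates some      *)
(* element of r. As k is infinite, the torus separates exponents, so a linear *)
(* combination of H-translates of f yields, for each s in r, some g_s in I    *)
(* supported in supp f with g_s(s) = 1 and g_s(t) = 0 for the other t in r.   *)
(* Hence x^s lies in I + sum_(t in r) x^t m, where m is the ideal of series   *)
(* without constant term. Since 1 - m consists of right invertible elements,  *)
(* Nakayama's elimination gives x^s in I for all s in r, and these monomials  *)
(* generate f. For L, contract to R and use that monomials are units of L.    *)

(** An [H]-ideal is not assumed closed under limits, and finite combinations of torus translates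
    cannot in general cut a single monomial out of an infinite series. They can, however, isolate an
    exponent among finitely many ([qseries_act_isolate]). With the exponents supplied by [dickson],
    the remaining terms are a combination of the same monomials whose coefficients lack a constant
    term ([qseries_div]). As [1 - a] is right invertible for such [a] ([qseries_rinv]),
    [nakayama_elim] removes this error. [H_ideal_monomials] assembles these facts and yields both
    parts. *)

Lemma dickson (n : nat) (P : set {ffun 'I_n -> nat}) :
  exists2 r : seq {ffun 'I_n -> nat}, (forall s, s \in r -> P s) &
    forall t, P t -> exists2 s, s \in r & forall i, (s i <= t i)%N.
Proof.
(* Induction on the number [m] of coordinates compared, for all sets [Q] at once, since it is
   applied to slices of [Q]. *)
suff H m (Q : set {ffun 'I_n -> nat}) :
    exists2 r : seq {ffun 'I_n -> nat}, (forall s, s \in r -> Q s) &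
      forall t, Q t -> exists2 s, s \in r &
        forall i : 'I_n, (i < m)%N -> (s i <= t i)%N.
  have [r rP Pr] := H n P; exists r => // t /Pr[s sr st].
  by exists s => // i; exact: st.
elim: m Q => [|m IH] Q.
  have [[s Qs]|/forallNP nQ] := pselect (exists s, Q s).
    by exists [:: s] => [t|t _]; [rewrite inE => /eqP->|exists s; rewrite ?inE].
  by exists [::] => // t /nQ.
have [mn|nm] := ltnP m n; last first.
  have [r rQ Qr] := IH Q; exists r => // t /Qr[s sr st].
  by exists s => // i _; apply: st; rewrite (leq_trans (ltn_ord i)).
pose j := Ordinal mn.
have [r rQ Qr] := IH Q.
have [N rN] : exists N, forall s, s \in r -> (s j <= N)%N.
  exists (\max_(s <- r) s j)%N => s sr; exact: leq_bigmax_seq.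
have /choice[F FP] c : exists r' : seq {ffun 'I_n -> nat},
    (forall s, s \in r' -> Q s /\ s j = c) /\
    forall t, Q t -> t j = c -> exists2 s, s \in r' &
      forall i : 'I_n, (i < m)%N -> (s i <= t i)%N.
  have [r' rQ' Qr'] := IH [set s | Q s /\ s j = c].
  by exists r'; split=> // t Qt tc; exact: Qr'.
(* If [t j >= N], an element of [r] below [t] in the earlier coordinates is also below it at [j].
   The other [t] lie in finitely many slices. *)
exists (r ++ flatten [seq F c | c <- iota 0 N]) => [s|t Qt].
  rewrite mem_cat => /orP[/rQ//|/flatten_mapP[c _]].
  by case: (FP c) => + _ => /[apply] -[].
have [tN|Nt] := ltnP (t j) N.
  have [FQ /(_ t Qt erefl)[s sF st]] := FP (t j).
  exists s.
    rewrite mem_cat; apply/orP; right; apply/flatten_mapP; exists (t j) => //.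
    by rewrite mem_iota.
  move=> i; rewrite ltnS leq_eqVlt => /orP[/eqP im|]; last exact: st.
  by rewrite (_ : i = j) ?(FQ _ sF).2//; exact/val_inj.
have [s sr st] := Qr t Qt; exists s; first by rewrite mem_cat sr.
move=> i; rewrite ltnS leq_eqVlt => /orP[/eqP im|]; last exact: st.
by rewrite (_ : i = j) ?(leq_trans (rN _ sr))//; exact/val_inj.
Qed.

Lemma expr_separation (k : fieldType) (a b : nat) :
  infinite_set [set: k] -> a != b -> exists2 c : k, c != 0 & c ^+ a != c ^+ b.
Proof.
(* A nonzero polynomial has finitely many roots; the extra factor ['X] makes any non-root
   nonzero. *)
move=> k_inf ab; pose p : {poly k} := ('X^a - 'X^b) * 'X.
have p0 : p != 0.
  rewrite mulf_neq0 ?polyX_eq0// subr_eq0; apply: contra ab => /eqP e.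
  by have := congr1 (size \o val) e => /=; rewrite !size_polyXn => -[->].
have [B _ Bp] := infinite_set_fset (size p) k_inf.
have : ~~ all (root p) (enum_fset B).
  apply/negP => /(max_poly_roots p0); rewrite fset_uniq => /(_ isT).
  by rewrite ltnNge Bp.
move=> /allPn[c _]; rewrite rootM rootX negb_or => /andP[pc c0].
exists c => //; apply: contra pc => /eqP e.
by rewrite rootE !hornerE e subrr.
Qed.

(** * Nakayama elimination for right multiples *)

Section Nakayama.
Variables (A : nzRingType) (K M : set A).
Hypotheses (K0 : K 0) (KD : forall x y, K x -> K y -> K (x + y))
  (KM : forall x a, K x -> K (x * a)).
Hypotheses (MD : forall x y, M x -> M y -> M (x + y))
  (MM : forall x a, M x -> M (x * a))
  (M_rinv : forall x, M x -> exists c, (1 - x) * c = 1).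

(** Modulo [K] the relations form a square linear system with coefficients in [M]. Each can be
    solved for its own unknown because [1 - M] is right invertible, so the unknowns are eliminated
    one by one. *)
Lemma nakayama_elim (T : eqType) (r : seq T) (y : T -> A) :
  (forall s, s \in r -> exists2 a : T -> A, (forall t, t \in r -> M (a t)) &
     K (y s - \sum_(t <- r) y t * a t)) ->
  forall s, s \in r -> K (y s).
Proof.
elim: r => // s0 r IH H.
have [a Ma] := H s0 (mem_head _ _); rewrite big_cons => Ka.
have [c ac] := M_rinv (Ma _ (mem_head _ _)).
have {}Ka : K (y s0 - \sum_(t <- r) y t * (a t * c)).
  have -> : \sum_(t <- r) y t * (a t * c) = (\sum_(t <- r) y t * a t) * c.
    by rewrite mulr_suml; under eq_bigr do rewrite mulrA.
  suff <- : (y s0 - y s0 * a s0) * c = y s0.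
    by rewrite -mulrBl -addrA -opprD; exact: KM.
  by rewrite -[X in X - _]mulr1 -mulrBr -mulrA ac mulr1.
(* Substituting the solved relation for [y s0] keeps the coefficients in [M]. *)
have Kr s : s \in r -> K (y s).
  apply: IH => {}s sr; have [|b Mb] := H s; first by rewrite inE sr orbT.
  rewrite big_cons => Kb; exists (fun t => b t + a t * c * b s0).
    move=> t tr; have tr' : t \in s0 :: r by rewrite inE tr orbT.
    by apply: MD; [exact: Mb|apply/MM/MM/Ma].
  have -> : \sum_(t <- r) y t * (b t + a t * c * b s0) =
      \sum_(t <- r) y t * b t + (\sum_(t <- r) y t * (a t * c)) * b s0.
    by under eq_bigr do rewrite mulrDr mulrA; rewrite big_split mulr_suml.
  have := KD Kb (KM (b s0) Ka).
  congr K; rewrite mulrBl [X in _ - X + _]addrC [in LHS]opprD addrA.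
  by rewrite addrA subrK -addrA -opprD.
move=> s; rewrite inE => /predU1P[->|/Kr//].
rewrite -(subrK (\sum_(t <- r) y t * (a t * c)) (y s0)); apply: KD => //.
by rewrite big_seq; elim/big_ind: _ => // t /Kr; exact: KM.
Qed.

End Nakayama.

(** * Inverses and monomial division in [R] *)

Section Series.
Variables (k : fieldType) (n : nat) (q : 'M[k]_n) (qP : mult_antisym q).
Local Notation R := (qseries qP).
Local Notation E := {ffun 'I_n -> nat}.
Implicit Types (f g : R) (s t u : E).

Let deg s := (\sum_i s i)%N.

Let degD s t : deg (s + t) = (deg s + deg t)%N.
Proof. by rewrite /deg -big_split; apply: eq_bigr => i _; rewrite ffunE. Qed.

Let deg_gt0 s : s != 0 -> (0 < deg s)%N.
Proof.
apply: contraR; rewrite -eqn0Ngt sum_nat_eq0 => /forallP s0.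
by apply/eqP/ffunP => i; rewrite ffunE; exact/eqP/s0.
Qed.

Lemma qseries_expr_eq0 (a : R) N u : a 0 = 0 -> (deg u < N)%N -> (a ^+ N) u = 0.
Proof.
move=> a0; elim: N u => // N IH u uN; rewrite exprS.
apply: twisted_conv_eq0 => s t stu as0.
have [s0|/deg_gt0 s0] := eqVneq s 0; first by rewrite s0 a0 eqxx in as0.
by rewrite [_ t]IH ?eqxx//; move: uN; rewrite -stu degD; lia.
Qed.

Lemma qseries_mul_congr f g g' u :
  (forall v, (deg v <= deg u)%N -> g v = g' v) -> (f * g) u = (f * g') u.
Proof.
move=> gg'; apply/eqP; rewrite -subr_eq0; apply/eqP.
transitivity ((f * (g - g')) u); first by rewrite mulrBr.
apply: twisted_conv_eq0 => s t stu _.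
have tu : (deg t <= deg u)%N by rewrite -stu degD leq_addl.
by move=> /eqP[]; rewrite /= gg'// subrr.
Qed.

(** The inverse is the geometric series of [a]. Powers of [a] beyond [deg u] do not reach the
    exponent [u], so each coefficient is read off a partial sum. *)
Lemma qseries_rinv (a : R) : a 0 = 0 -> exists c : R, (1 - a) * c = 1.
Proof.
move=> a0; pose B N : R := \sum_(i < N.+1) a ^+ i.
have BE N v : (deg v <= N)%N -> B N v = B (deg v) v.
  move=> vN; rewrite -(subnKC vN); elim: (N - _)%N => [|d IH]; first by rewrite addn0.
  rewrite addnS /B big_ord_recr -[LHS]/(B (deg v + d)%N v + (a ^+ _) v) IH.
  by rewrite qseries_expr_eq0 ?addr0//= ltnS leq_addr.
exists (QSeries qP (fun u => B (deg u) u)); apply/qseriesP => u.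
rewrite (@qseries_mul_congr _ _ (B (deg u))) => [|v vu]; last by rewrite BE.
rewrite (_ : (1 - a) * B (deg u) = 1 - a ^+ (deg u).+1).
  by rewrite -[LHS]/(_ - (a ^+ (deg u).+1) u) qseries_expr_eq0 ?subr0.
by rewrite -opprB mulNr -subrX1 opprB.
Qed.

Lemma qseries_monoMl_coef s (a : R) t :
  (qseries_mono qP s * a) (s + t) = qcoef q s t * a t.
Proof. by apply: twisted_conv_monol; exact: natE_addI. Qed.

Lemma qseries_monoMl_eq0 s (a : R) t :
  ~~ [forall i, s i <= t i]%N -> (qseries_mono qP s * a) t = 0.
Proof.
move=> st; apply: twisted_conv_eq0 => s' v s'vt /=.
case: (eqVneq s' s) => [e _ _|_ /eqP[]//].
by case/negP: st; apply/forallP => i; rewrite -s'vt e ffunE leq_addr.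
Qed.

Lemma exp_subE s t : [forall i, s i <= t i]%N -> exists v, t = s + v.
Proof.
move=> /forallP st; exists [ffun i => t i - s i]%N; apply/ffunP => i.
by rewrite !ffunE; exact/esym/subnKC/st.
Qed.

(** Each term of [g] is allotted to the first [s] in [r] that divides it. The constant term of [a s]
    can thus only come from the coefficient of [g] at [s] itself. *)
Lemma qseries_div (r : seq E) g : uniq r ->
  (forall t, g t != 0 -> exists2 s, s \in r & forall i, (s i <= t i)%N) ->
  exists2 a : E -> R, g = \sum_(s <- r) qseries_mono qP s * a s &
    forall s, g s = 0 -> a s 0 = 0.
Proof.
elim: r g => [|s r IH] g /= => [_|/andP[sr ur]] gr.
  exists (fun=> 0) => //; rewrite big_nil; apply/qseriesP => t /=.
  by apply/eqP; apply: contraT => /gr[].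
pose g' : R := QSeries qP (fun t => if [forall i, s i <= t i]%N then 0 else g t).
(* The inverse scalar cancels the one produced by [x^s x^v]. *)
pose a0 : R := QSeries qP (fun v => (qcoef q s v)^-1 * g (s + v)).
have gE : g = qseries_mono qP s * a0 + g'.
  apply/qseriesP => t; rewrite -[RHS]/((qseries_mono qP s * a0) t + g' t).
  have [st|st] := boolP [forall i, s i <= t i]%N; last first.
    by rewrite qseries_monoMl_eq0//= (negPf st) add0r.
  have [v tE] := exp_subE st.
  rewrite tE qseries_monoMl_coef/= mulVKf ?qcoef_neq0//.
  by rewrite ifT ?addr0// -tE.
have [t|a ag' a0E] := IH g' ur.
  rewrite /=; case: ifPn => [_|st /gr[v]]; first by rewrite eqxx.
  rewrite inE => /predU1P[->{v} /forallP vt|vr vt]; last by exists v.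
  by rewrite vt in st.
exists (fun t => if t == s then a0 else a t) => [|t gt].
  rewrite big_cons eqxx {1}gE ag'; congr (_ + _); apply: eq_big_seq => t tr.
  by rewrite ifN//; apply: contraNneq sr => <-.
case: eqVneq => [ts|_]; first by rewrite /= -ts addr0 gt mulr0.
by apply: a0E; rewrite /= gt if_same.
Qed.

(** * Isolating exponents by the torus; monomials in [H]-ideals *)

Lemma qseries_act_separation (I : set R) f (s t : E) :
  infinite_set [set: k] -> H_ideal (@torus k n) (@qseries_act k n q qP) I ->
  s != t -> I f ->
  exists2 d : E -> k, d s = 1 /\ d t = 0 &
    I (QSeries qP (fun u => d u * f u)).
Proof.
move=> k_inf [[_ IB IM _] Ih] st If.
have [i sti] : exists i, s i != t i.
  apply/existsP; rewrite -negb_forall; apply: contra st => /forallP st.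
  by apply/eqP/ffunP => i; exact/eqP.
have [c c0 cst] := expr_separation k_inf sti.
pose h := [ffun j : 'I_n => if j == i then c else 1].
have hE u : \prod_j h j ^+ u j = c ^+ u i.
  rewrite (bigD1 i)//= ffunE eqxx big1 ?mulr1// => j ji.
  by rewrite ffunE (negPf ji) expr1n.
have hT : torus h by move=> j; rewrite ffunE; case: ifP => //; rewrite oner_eq0.
(* A Lagrange factor: [h] multiplies the coefficient at [u] by [c ^+ u i], so subtracting [c ^+ t i]
   times [f] kills [t], and the inverse normalizes at [s]. *)
exists (fun u => (c ^+ s i - c ^+ t i)^-1 * (c ^+ u i - c ^+ t i)).
  by rewrite subrr mulr0 mulVf// subr_eq0.
have := IM (c ^+ s i - c ^+ t i)^-1%:A _ (IB _ _ (Ih h f hT If)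
  (IM (c ^+ t i)%:A _ If)).
rewrite -!scalerAl !mul1r; congr I; apply/qseriesP => u /=.
by rewrite hE -mulrBl mulrA.
Qed.

Lemma qseries_act_isolate (I : set R) f (s : E) (r : seq E) :
  infinite_set [set: k] -> H_ideal (@torus k n) (@qseries_act k n q qP) I ->
  I f -> exists2 d : E -> k,
    d s = 1 /\ (forall t, t \in r -> t != s -> d t = 0) &
    I (QSeries qP (fun u => d u * f u)).
Proof.
move=> k_inf HI If; elim: r => [|t r [d [ds dr] Id]].
  by exists (fun=> 1) => //; congr I: If; apply/qseriesP => u; rewrite /= mul1r.
have [->|ts] := eqVneq t s.
  by exists d => //; split=> // v; rewrite inE => /predU1P[->|/dr//]; rewrite eqxx.
have [|d' [d's d't] Id'] := qseries_act_separation k_inf HI _ Id (s := s) (t := t).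
  by rewrite eq_sym.
exists (fun u => d' u * d u); last first.
  by congr I: Id'; apply/qseriesP => u; rewrite /= mulrA.
split=> [|v]; first by rewrite ds d's mulr1.
by rewrite inE => /predU1P[->|/dr /[apply] ->]; rewrite ?d't ?mul0r ?mulr0.
Qed.

Lemma H_ideal_monomials (I : set R) f :
  infinite_set [set: k] -> H_ideal (@torus k n) (@qseries_act k n q qP) I ->
  I f -> exists r : seq E, [/\ uniq r, forall s, s \in r -> I (qseries_mono qP s) &
    forall t, f t != 0 -> exists2 s, s \in r & forall i, (s i <= t i)%N].
Proof.
move=> k_inf HI If; have [[I0 IB IM MI] _] := HI.
have IN x : I x -> I (- x) by move=> Ix; rewrite -sub0r; exact: IB.
have ID x y : I x -> I y -> I (x + y).
  by move=> Ix /IN Iy; rewrite -[y]opprK; exact: IB.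
have [r' rf fr] := dickson [set s | f s != 0].
pose r := undup r'; exists r; split; first exact: undup_uniq.
  apply: (@nakayama_elim _ I [set a : R | a 0 = 0] I0 ID _ _ _ qseries_rinv).
  - by move=> x a /MI.
  - by move=> x y /= -> ->; rewrite addr0.
  - move=> x a /= x0; apply: twisted_conv_eq0 => s t /ffunP st xs _.
    have s0 : s = 0.
      apply/ffunP => i; have := st i; rewrite !ffunE => /eqP; rewrite addn_eq0.
      by move=> /andP[/eqP].
    by rewrite s0 x0 eqxx in xs.
  move=> s sr; have [d [ds dr] Id] := qseries_act_isolate s r k_inf HI If.
  have fs : f s != 0 by apply: rf; rewrite -mem_undup.
  pose g : R := (f s)^-1 *: QSeries qP (fun u => d u * f u).
  have Ig : I g.
    by rewrite /g -[QSeries _ _]mul1r scalerAl; exact: IM.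
  (* [g] agrees with [x^s] at every exponent in [r], so the quotients of the difference have no
     constant term there. *)
  have [||a ga a0] := @qseries_div r (qseries_mono qP s - g).
  - exact: undup_uniq.
  - move=> t /=; case: (eqVneq t s) => [-> _|ts]; first by exists s.
    rewrite sub0r oppr_eq0 !mulf_eq0 !negb_or => /and3P[_ _ ft].
    by have [v] := fr t ft; rewrite -mem_undup; exists v.
  exists a => [t tr|]; last by rewrite -ga opprB addrC subrK.
  apply: a0 => /=; case: (eqVneq t s) => [->|ts]; first by rewrite ds mul1r mulVf// subrr.
  by rewrite dr// mul0r mulr0 subrr.
by move=> t /fr[s]; rewrite -mem_undup; exists s.
Qed.

End Series.

Theorem proposition3p3 (k : fieldType) (k_inf : infinite_set [set: k])
    (n : nat) (n_gt0 : (0 < n)%N) (q : 'M[k]_n) (qP : mult_antisym q) :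
  (forall I : set (qseries qP),
     H_ideal (@torus k n) (@qseries_act k n q qP) I -> I <> [set 0] ->
     exists S : set {ffun 'I_n -> nat},
       I = ideal_gen [set qseries_mono qP s | s in S]) /\
  H_simple (@torus k n) (@qlaurent_act k n q qP).
Proof.
split=> [I HI _|I [[I0 IB IM MI] Ih]].
  exists [set s | I (qseries_mono qP s)]; apply/seteqP; split=> f.
    move=> /(H_ideal_monomials k_inf HI)[r [ur Ir fr]] J [[J0 JB JM MJ] JS].
    have [a -> _] := qseries_div ur fr; rewrite big_seq.
    elim/big_ind: _ => // [x y Jx Jy|s /Ir Is].
      by rewrite -[y]opprK -[- y]sub0r; apply: (JB) => //; exact: JB.
    by apply: MJ; apply: JS; exists s.
  by apply; split=> [|_ [s Is <-]//]; case: HI.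
have [[f If f0]|/forall2NP If0] := pselect (exists2 f, I f & f <> 0); [right|left].
  (* Clearing denominators brings [f] into the contraction [J] of [I] to [R]. *)
  have [s [g sfg]] := qlaurent_fraction f.
  pose J := [set x | I (@qlaurent_of_series k n q qP x)].
  have HJ : H_ideal (@torus k n) (@qseries_act k n q qP) J.
    split; last by move=> h x /Ih /[apply]; rewrite qlaurent_act_embed.
    split; rewrite /J /= ?raddf0// => x y.
    - by rewrite rmorphB; exact: IB.
    - by rewrite rmorphM; exact: IM.
    - by rewrite rmorphM; exact: MI.
  have Jg : J g by rewrite /J /= -sfg; exact: IM.
  have [r [_ rJ gr]] := H_ideal_monomials k_inf HJ Jg.
  (* If [g] vanished, so would [f], because [x^s] is a unit of [L]. *)
  have [t gt] : exists t, g t != 0.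
    apply/not_existsP => g0; apply: f0.
    have [y [ys _]] := qlaurent_mono_unit qP (expz s).
    rewrite -[f]mul1r -ys -mulrA -embed_mono sfg (_ : g = 0) ?raddf0 ?mulr0//.
    by apply/qseriesP => t; apply/eqP; apply: contrapT => /negP/g0.
  (* A term of [g] forces a monomial into [J], hence a unit of [L] into [I]. *)
  have [v /rJ + _] := gr t gt; rewrite /J /= embed_mono => Iv.
  have [y [yv _]] := qlaurent_mono_unit qP (expz v).
  apply/seteqP; split=> // x _.
  by rewrite -[x]mulr1 -yv mulrA; exact: IM.
apply/seteqP; split=> [f If|_ -> //].
by have [//|/contrapT] := If0 f.
Qed.
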